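(* Fix $\varepsilon>0$ and $\gamma\in(0,1)$, and let $d_N=(1-\gamma)\sqrt{\frac{\log N}{2\log\log N}}$. For an abelian group $G$ of order $N$, an integer $d$ with $2\leqslant d\leqslant d_N$, and $p\leqslant \sqrt[d]{\frac{d!(1-\varepsilon)}{2^d}\cdot\frac{\log N}{N^{d-1}}}$, let $\Gamma\in\mathcal{G}(G,p)$. Then with high probability the diameter of $\Gamma$ is greater than $d$; that is, $\Pr(\operatorname{diam}(\Gamma)\leqslant d)\to 0$ as $N\to\infty$, uniformly over all abelian groups $G$ of order $N$, all such $d$ and all such $p$.
   Context: For a group $G$ and a subset $S\subseteq G$, the (undirected) Cayley graph $\Gamma(G;S)$ has vertex set $G$ and an edge between $g\neq h$ iff $g^{-1}h\in S$ or $h^{-1}g\in S$ (loops and multiple edges ignored). The model $\mathcal{G}(G,p)$ is the probability space of Cayley graphs $\Gamma(G;S)$ where each element of $G$ is put in $S$ independently with probability $p$. The diameter of a disconnected graph is infinite. ''With high probability'' means the error probability tends to $0$ as $N\to\infty$, uniformly over the class of groups under consideration. *)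

(* Defs.v *)
From HB Require Import structures.
From mathcomp Require Import all_boot all_order all_algebra all_fingroup.
From mathcomp Require Import reals exp.
Set Implicit Arguments. Unset Strict Implicit. Unset Printing Implicit Defensive.
Import Order.TTheory GRing.Theory Num.Theory.
Local Open Scope ring_scope.

Section Cayley.
Variable gT : finGroupType.

Definition cay_adj (S : {set gT}) (g h : gT) : bool :=
  (g != h) && (((g^-1 * h)%g \in S) || ((h^-1 * g)%g \in S)).

Fixpoint within (S : {set gT}) (k : nat) (g h : gT) : bool :=
  match k with
  | 0 => g == h
  | k'.+1 => within S k' g h || [exists x, cay_adj S g x && within S k' x h]
  end.

(* diam(Gamma(G;S)) <= d  (a disconnected graph has infinite diameter). *)
Definition diam_le (S : {set gT}) (d : nat) : bool :=
  [forall g, forall h, within S d g h].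

Definition cayley_prob (R : realType) (p : R) (E : pred {set gT}) : R :=
  \sum_(S : {set gT} | E S) p ^+ #|S| * (1 - p) ^+ (#|gT| - #|S|).
End Cayley.

Definition dN (R : realType) (gam : R) (N : nat) : R :=
  (1 - gam) * Num.sqrt (ln (N%:R) / (2 * ln (ln (N%:R)))).

(* (d! (1-eps) / 2^d) * (log N / N^(d-1)) : the d-th power of the bound on p *)
Definition pbound_pow (R : realType) (eps : R) (d N : nat) : R :=
  ((d`!)%:R * (1 - eps) / 2 ^+ d) * (ln (N%:R) / (N%:R) ^+ (d.-1)).

(* Main.v *)
(* Call x uncovered by S if it is at distance more than d from 1. Covering x
   means that S contains either a d-element set T from which x is a product of
   all elements up to signs (a "main" set of x), or a smaller set generating x
   within d steps. The main sets of x number at most 2^d N^(d-1) / d!, so their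
   expected number inside S is at most (1 - eps) log N, while the smaller sets
   contribute o(1) for at least half of the x. Hence the expected number of
   uncovered x is at least N^(eps/2) / 4, and the second moment method applies
   once P(x and y uncovered) <= (1 + o(1)) P(x uncovered) P(y uncovered) for all
   but few pairs. Both sides are compared with products of the 1 - p^|T|, from
   below by Harris' inequality and from above by Janson's. Both inequalities
   follow from E[1(T in S) f(S)] = p^|T| E[f(T u S)]. The condition d <= d_N is
   used as N >= (log N)^(2 d^2), which makes N p at the threshold larger than
   the combinatorial factors d^O(d) (log N)^O(1) in the error terms. *)
Require Import Defs.
From HB Require Import structures.
From mathcomp Require Import all_boot all_order all_algebra all_fingroup.
From mathcomp Require Import reals sequences exp.
From mathcomp Require Import ring lra zify.
Set Implicit Arguments. Unset Strict Implicit. Unset Printing Implicit Defensive.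
Import Order.TTheory GRing.Theory Num.Theory.
Local Open Scope ring_scope.

(** * Random subsets *)

Lemma sum_containing (R : nmodType) (X : finType) (t : X) (g : {set X} -> R) :
  \sum_(S : {set X} | t \in S) g S =
  \sum_(S : {set X} | t \notin S) g (t |: S).
Proof.
rewrite (reindex_onto (fun S => t |: S) (fun S => S :\ t)) /=; last first.
  by move=> S tS; rewrite setD1K.
apply: eq_bigl => S; rewrite setU11 /=.
apply/eqP/idP => [<-|/setU1K //]; by rewrite !inE eqxx.
Qed.

(** Double counting: deleting the marked point turns a pair with [t] in [T] into a pair with [t]
    outside [T]. Main sets are later counted through what is left after one deletion. *)
Lemma sum_pointed_sets (R : nmodType) (X : finType) (F : {set X} -> X -> R) :
  \sum_(T : {set X}) \sum_(t in T) F T t =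
  \sum_(T : {set X}) \sum_(t in ~: T) F (t |: T) t.
Proof.
rewrite (exchange_big_dep xpredT) //= [RHS](exchange_big_dep xpredT) //=.
apply: eq_bigr => t _; rewrite sum_containing.
by apply: eq_bigl => T; rewrite inE.
Qed.

Section RandomSubset.
Variables (R : realType) (X : finType) (p : R).

Definition subset_weight (S : {set X}) : R :=
  p ^+ #|S| * (1 - p) ^+ (#|X| - #|S|).

Definition subset_mean (f : {set X} -> R) : R :=
  \sum_(S : {set X}) subset_weight S * f S.

Definition avoids (F : seq {set X}) (S : {set X}) : bool :=
  all (fun T : {set X} => ~~ (T \subset S)) F.

(** Expanding the product over [X] of [p + (1 - p)] gives one term for each subset. *)
Lemma subset_mean1 : subset_mean (fun=> 1) = 1.
Proof.
have e : \prod_(i : X) (p + (1 - p)) = 1.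
  by rewrite big1 // => i _; rewrite addrC subrK.
rewrite -[RHS]e bigA_distr; apply: eq_bigr => S _.
rewrite mulr1 (bigID (mem S)) /=; congr (_ * _).
  rewrite (eq_bigr (fun=> p)) => [|i ->//].
  by rewrite prodr_const.
rewrite (eq_bigr (fun=> 1 - p)) => [|i /negbTE->//].
rewrite prodr_const; congr (_ ^+ _).
by rewrite -(cardsC S) addKn; apply: eq_card => i; rewrite !inE.
Qed.

Lemma eq_subset_mean f g : f =1 g -> subset_mean f = subset_mean g.
Proof. by move=> e; apply: eq_bigr => S _; rewrite e. Qed.

Lemma subset_meanZ c f :
  subset_mean (fun S => c * f S) = c * subset_mean f.
Proof. by rewrite mulr_sumr; apply: eq_bigr => S _; rewrite mulrCA. Qed.

Lemma subset_meanD f g :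
  subset_mean (fun S => f S + g S) = subset_mean f + subset_mean g.
Proof. by rewrite -big_split; apply: eq_bigr => S _; rewrite mulrDr. Qed.

Lemma subset_mean_sum (I : Type) (r : seq I) (P : pred I) f :
  subset_mean (fun S => \sum_(i <- r | P i) f i S) =
  \sum_(i <- r | P i) subset_mean (f i).
Proof.
by rewrite exchange_big; apply: eq_bigr => S _; rewrite mulr_sumr.
Qed.

(** For [t] outside [S], the weight of [t |: S] is [p] times the joint weight of [S] and [t |: S],
    and [f (t |: S)] is the same for both. *)
Lemma subset_mean_shift1 t f :
  subset_mean (fun S => (t \in S)%:R * f S) =
  p * subset_mean (fun S => f (t |: S)).
Proof.
rewrite /subset_mean (bigID (fun S : {set X} => t \in S)) /= addrC big1 ?add0r.
  rewrite [in RHS](bigID (fun S : {set X} => t \in S)) /= !sum_containing.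
  rewrite -big_split mulr_sumr; apply: eq_bigr => S tS.
  have -> : t |: (t |: S) = t |: S by rewrite setUA setUid.
  rewrite setU11 mul1r /subset_weight cardsU1 tS add1n.
  have SX : (#|S| < #|X|)%N.
    by rewrite -cardsT; apply: proper_card; apply/properP; split;
      [exact: subsetT | exists t].
  have -> : (#|X| - #|S| = (#|X| - #|S|.+1).+1)%N by lia.
  by rewrite !exprS /=; ring.
by move=> S /negbTE->; rewrite mul0r mulr0.
Qed.

(** Conditioning on [T \subset S], written without a division, so that [p = 0] is no special
    case. *)
Lemma subset_mean_shift (T : {set X}) f :
  subset_mean (fun S => (T \subset S)%:R * f S) =
  p ^+ #|T| * subset_mean (fun S => f (T :|: S)).
Proof.
elim: {T}#|T| {-2}T (erefl #|T|) f => [|n IH] T cT f.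
  move/cards0_eq: (cT) => ->; rewrite cards0 mul1r; apply: eq_subset_mean => S.
  by rewrite sub0set mul1r set0U.
have [t tT] : exists t, t \in T by apply/card_gt0P; rewrite cT.
have cT' : #|T :\ t| = n by move: cT; rewrite (cardsD1 t) tT add1n => -[].
have split_t (S : {set X}) : (T \subset S)%:R * f S =
    (t \in S)%:R * ((T :\ t \subset S)%:R * f S).
  rewrite -{1}(setD1K tT) subUset sub1set.
  by case: (t \in S); rewrite ?mul1r ?mul0r.
rewrite (eq_subset_mean split_t) subset_mean_shift1 cT exprS -mulrA; congr (_ * _).
have sub_t (S : {set X}) : (T :\ t \subset t |: S) = (T :\ t \subset S).
  by rewrite -subDset setDDl setUid.
rewrite -cT'.
have sub_tf (S : {set X}) : (T :\ t \subset t |: S)%:R * f (t |: S) =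
    (T :\ t \subset S)%:R * f (t |: S) by rewrite sub_t.
rewrite (eq_subset_mean sub_tf) (IH _ cT' (fun S => f (t |: S))) cT'.
by congr (_ * _); apply: eq_subset_mean => S; rewrite setUA setD1K.
Qed.

Hypothesis p01 : 0 <= p <= 1.

Lemma subset_weight_ge0 S : 0 <= subset_weight S.
Proof. by case/andP: p01 => p0 p1; rewrite mulr_ge0 ?exprn_ge0 ?subr_ge0. Qed.

Lemma le_subset_mean f g :
  (forall S, f S <= g S) -> subset_mean f <= subset_mean g.
Proof.
by move=> fg; apply: ler_sum => S _; rewrite ler_wpM2l ?subset_weight_ge0.
Qed.

Lemma subset_mean_ge0 f : (forall S, 0 <= f S) -> 0 <= subset_mean f.
Proof.
by move=> f0; apply: sumr_ge0 => S _; rewrite mulr_ge0 ?subset_weight_ge0.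
Qed.

Definition avoid_prob F : R := subset_mean (fun S => (avoids F S)%:R).

Lemma avoid_prob_ge0 F : 0 <= avoid_prob F.
Proof. exact: subset_mean_ge0. Qed.

Lemma avoids_subset F (S S' : {set X}) :
  S \subset S' -> avoids F S' -> avoids F S.
Proof.
move=> SS' /allP avF; apply/allP => T /avF; apply: contra => TS.
exact: subset_trans SS'.
Qed.

(** Avoiding [F] is a decreasing event: it only becomes harder when [T] is added to [S]. *)
Lemma avoid_prob_contain F (T : {set X}) :
  subset_mean (fun S => (T \subset S)%:R * (avoids F S)%:R) <=
  p ^+ #|T| * avoid_prob F.
Proof.
case/andP: p01 => p0 _; rewrite subset_mean_shift ler_wpM2l ?exprn_ge0 //.
apply: le_subset_mean => S; rewrite ler_nat.
have := @avoids_subset F S (T :|: S) (subsetUr _ _).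
by case: (avoids F (T :|: S)) => // ->.
Qed.

Lemma avoid_prob_cons F (T : {set X}) :
  avoid_prob (T :: F) = avoid_prob F -
    subset_mean (fun S => (T \subset S)%:R * (avoids F S)%:R).
Proof.
apply/eqP; rewrite -subr_eq opprK -subset_meanD; apply/eqP.
apply: eq_subset_mean => S /=.
by case: (T \subset S); rewrite /= ?mul1r ?mul0r ?add0r ?addr0.
Qed.

(** Harris' inequality: by [avoid_prob_contain], each further set costs at most the factor
    [1 - p ^+ #|T|]. *)
Lemma avoid_prob_ge (F : seq {set X}) :
  \prod_(T <- F) (1 - p ^+ #|T|) <= avoid_prob F.
Proof.
case/andP: p01 => p0 p1.
elim: F => [|T F IH]; first by rewrite big_nil /avoid_prob subset_mean1.
rewrite big_cons avoid_prob_cons.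
apply: le_trans (_ : (1 - p ^+ #|T|) * avoid_prob F <= _).
  by rewrite ler_wpM2l // subr_ge0 exprn_ile1.
by rewrite mulrBl mul1r lerB // avoid_prob_contain.
Qed.

(* Janson's inequality, conditioning on one set at a time: the sets disjoint
   from [T] are independent of [T], the others are removed by a union bound. *)
Lemma avoid_prob_cons_le (F : seq {set X}) (T : {set X}) :
  avoid_prob (T :: F) <= avoid_prob F *
   (1 - p ^+ #|T| + \sum_(T' <- F | ~~ [disjoint T & T']) p ^+ #|T :|: T'|).
Proof.
case/andP: p01 => p0 p1.
set D := \sum_(_ <- _ | _) _; rewrite avoid_prob_cons.
pose F0 := [seq T' : {set X} <- F | [disjoint T & T']].
have F0F (S : {set X}) : avoids F S -> avoids F0 S.
  by move/allP=> h; apply/allP => U; rewrite mem_filter => /andP[_ /h].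
have QF0 : avoid_prob F <= avoid_prob F0.
  apply: le_subset_mean => S; rewrite ler_nat.
  by have := @F0F S; case: (avoids F S) => // ->.
have key : avoid_prob F0 * (p ^+ #|T| - D) <=
    subset_mean (fun S => (T \subset S)%:R * (avoids F S)%:R).
  rewrite mulrBr.
  have -> : avoid_prob F0 * p ^+ #|T| =
      subset_mean (fun S => (T \subset S)%:R * (avoids F0 S)%:R).
    rewrite subset_mean_shift mulrC; congr (_ * _).
    apply: eq_subset_mean => S; congr (nat_of_bool _)%:R.
    apply: eq_in_all => U; rewrite mem_filter => /andP[TU _]; congr (~~ _).
    apply/idP/idP => US; first exact: subset_trans US (subsetUr _ _).
    apply/subsetP => x xU; move/subsetP: US => /(_ x xU).
    by rewrite inE (disjointFl TU xU).
  rewrite lerBlDr /D mulr_sumr.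
  (* Pointwise union bound: if [S] contains [T] and avoids [F0] but not [F], then [S] contains some
     set of [F] that meets [T]. *)
  apply: le_trans (_ : _ <= subset_mean (fun S =>
      (T \subset S)%:R * (avoids F S)%:R +
      \sum_(T' <- F | ~~ [disjoint T & T'])
        (T :|: T' \subset S)%:R * (avoids F0 S)%:R)) _.
    apply: le_subset_mean => S; case TS: (T \subset S); last first.
      by rewrite !mul0r add0r sumr_ge0 // => U _; rewrite mulr_ge0.
    rewrite !mul1r; case avF: (avoids F S).
      rewrite (F0F _ avF) lerDl sumr_ge0 // => U _; exact: mulr_ge0.
    case avF0: (avoids F0 S); last first.
      by rewrite add0r sumr_ge0 // => U _; exact: mulr_ge0.
    move/negbT/allPn: avF => [U UF]; rewrite negbK => US.
    have TU : ~~ [disjoint T & U].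
      apply/negP => TU; move/allP: avF0 => /(_ U).
      by rewrite mem_filter TU UF US => /(_ isT).
    rewrite add0r (big_rem U UF) /= TU subUset TS US mul1r lerDl sumr_ge0 //.
    by move=> V _; exact: mulr_ge0.
  rewrite subset_meanD subset_mean_sum lerD2l; apply: ler_sum => U _.
  by rewrite mulrC avoid_prob_contain.
have Q0 := avoid_prob_ge0 F.
have : avoid_prob F * (p ^+ #|T| - D) <=
    subset_mean (fun S => (T \subset S)%:R * (avoids F S)%:R).
  (* Passing from [F0] to [F] needs a nonnegative factor; for a negative one the left side is at
     most 0 already. *)
  have [pD|pD] := leP 0 (p ^+ #|T| - D).
    by apply: le_trans key; rewrite ler_wpM2r.
  apply: (@le_trans _ _ 0); first by rewrite mulr_ge0_le0 // ltW.
  by apply: subset_mean_ge0 => S; rewrite mulr_ge0.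
rewrite !(mulrDr, mulrBr); lra.
Qed.

(** Iterates the previous bound for sets of one size. In each round the correction runs only over
    the sets further down the list, hence is at most [c]. *)
Lemma avoid_prob_le (k : nat) (c : R) (F : seq {set X}) :
  uniq F -> (forall T, T \in F -> #|T| = k) ->
  (forall T, T \in F -> \sum_(T' <- F | (T' != T) && ~~ [disjoint T & T'])
                          p ^+ #|T :|: T'| <= c) ->
  avoid_prob F <= (1 - p ^+ k + c) ^+ size F.
Proof.
case/andP: p01 => p0 p1.
elim: F => [|T F IH] /=; first by rewrite /avoid_prob subset_mean1.
case/andP=> TF uF cF sF.
have c0 : 0 <= c.
  apply: le_trans (sF T _); rewrite ?mem_head //.
  by apply: sumr_ge0 => U _; rewrite exprn_ge0.
apply: le_trans (avoid_prob_cons_le _ _) _; rewrite exprSr.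
apply: ler_pM; rewrite ?avoid_prob_ge0 //.
- rewrite addr_ge0 ?subr_ge0 ?exprn_ile1 //.
  by apply: sumr_ge0 => U _; rewrite exprn_ge0.
- apply: IH => // U UF; first by apply: cF; rewrite inE UF orbT.
  apply: le_trans (sF U _); last by rewrite inE UF orbT.
  by rewrite big_cons; case: ifP => // _; rewrite lerDr exprn_ge0.
rewrite (cF T) ?mem_head // lerD2l; apply: le_trans (sF T _); rewrite ?mem_head //.
(* Since [F] does not repeat [T], the condition [T' != T] holds throughout the tail. *)
rewrite big_cons eqxx /= big_seq_cond [leRHS]big_seq_cond.
rewrite le_eqVlt; apply/orP; left; apply/eqP; apply: eq_bigl => U.
by case UF: (U \in F) => //=; case: eqP => // UT; rewrite -UT UF in TF.
Qed.
End RandomSubset.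

(** * Signed products and distances in Cayley graphs *)

Section SignedProducts.
Variable gT : finGroupType.
Implicit Types (S T : {set gT}) (x y t : gT) (k : nat).
Local Open Scope nat_scope.

(* This forces #|T| = k: every element of T is used exactly once. *)
Fixpoint signed_prod k (T : {set gT}) (x : gT) : bool :=
  if k is k'.+1 then
    [exists t in T, signed_prod k' (T :\ t) (t^-1 * x)%g
                    || signed_prod k' (T :\ t) (t * x)%g]
  else (T == set0) && (x == 1%g).

Lemma signed_prodS k T x : signed_prod k.+1 T x =
  [exists t in T, signed_prod k (T :\ t) (t^-1 * x)%g
                  || signed_prod k (T :\ t) (t * x)%g].
Proof. by []. Qed.

Lemma signed_prod_card k T x : signed_prod k T x -> #|T| = k.
Proof.
elim: k T x => [|k IH] T x /=; first by case/andP=> /eqP->; rewrite cards0.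
case/exists_inP=> t tT h; rewrite (cardsD1 t) tT add1n; congr _.+1.
by case/orP: h => /IH.
Qed.

(** Left translations are automorphisms of the Cayley graph. *)
Lemma within_translate S k (g h : gT) :
  within S k g h = within S k 1%g (g^-1 * h)%g.
Proof.
elim: k g h => [|k IH] g h /=; first by rewrite [RHS]eq_sym -eq_mulVg1.
have adjE x : cay_adj S 1%g (g^-1 * x)%g = cay_adj S g x.
  by rewrite /cay_adj [_ == (_ * _)%g]eq_sym -eq_mulVg1 invMg !invgK !invg1 mul1g mulg1.
have wE x : within S k (g^-1 * x)%g (g^-1 * h)%g = within S k x h.
  by rewrite IH [RHS]IH invMg invgK mulgA mulgK.
rewrite IH; congr (_ || _); apply/existsP/existsP => -[x].
  by move=> h'; exists (g^-1 * x)%g; rewrite adjE wE.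
by move=> h'; exists (g * x)%g; rewrite -adjE -wE mulKg.
Qed.

(** Replaces adjacency by multiplication with a generator or its inverse, which is the form of the
    recursion for [signed_prod]. *)
Lemma withinS S k x : within S k.+1 1%g x =
  within S k 1%g x || [exists s in S,
     within S k 1%g (s^-1 * x)%g || within S k 1%g (s * x)%g].
Proof.
rewrite /=; apply/orP/orP => -[->|]; try by left.
  case/existsP=> y; rewrite /cay_adj invg1 mul1g mulg1 => /andP[/andP[_ yS]].
  rewrite within_translate => w; right; apply/exists_inP.
  by case/orP: yS => yS; [exists y | exists y^-1%g] => //; rewrite ?invgK w ?orbT.
have step y : (y \in S) || (y^-1%g \in S) -> within S k 1%g (y^-1 * x)%g ->
    within S k 1%g x \/ [exists y, cay_adj S 1%g y && within S k y x].
  (* The identity as a generator gives no edge, loops being ignored; the step is then void and [k]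
     steps suffice. *)
  move=> yS w; case: (eqVneq y 1%g) => [y1|y1].
    by left; move: w; rewrite y1 invg1 mul1g.
  right; apply/existsP; exists y; rewrite within_translate w andbT /cay_adj.
  by rewrite eq_sym y1 invg1 mul1g mulg1.
case/exists_inP=> s sS /orP[]; first by apply: step; rewrite sS.
by move=> w; apply: (step s^-1%g); rewrite invgK ?sS ?orbT.
Qed.

Lemma within_subset S T k x : T \subset S -> within T k 1%g x -> within S k 1%g x.
Proof.
move=> TS; elim: k x => [|k IH] x //; rewrite !withinS.
case/orP=> [/IH->//|/exists_inP[s sT h]]; apply/orP; right.
apply/exists_inP; exists s; first exact: (subsetP TS).
by case/orP: h => /IH ->; rewrite ?orbT.
Qed.

Lemma signed_prod_within k T x : signed_prod k T x -> within T k 1%g x.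
Proof.
elim: k T x => [|k IH] T x; first by case/andP=> _ /eqP->; exact: eqxx.
case/exists_inP=> t tT h; rewrite withinS; apply/orP; right.
apply/exists_inP; exists t => //.
by case/orP: h => /IH /(within_subset (subsetDl _ _)) ->; rewrite ?orbT.
Qed.

(** Take for [T] the generators used by a walk of length at most [k]. Either [k] distinct ones
    occur, once each, or there are fewer than [k]. This is the split into main and small sets. *)
Lemma within_support S k x : within S k 1%g x ->
  exists2 T : {set gT}, T \subset S &
    signed_prod k T x || (#|T| < k) && within T k 1%g x.
Proof.
elim: k x => [|k IH] x.
  by move=> /eqP<-; exists set0; rewrite ?sub0set //= !eqxx.
have sub_case T y : signed_prod k T y || (#|T| < k) && within T k 1%g y ->
    (#|T| <= k) && within T k 1%g y.
  case/orP=> [h|/andP[/ltnW-> //]].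
  by rewrite (signed_prod_card h) leqnn signed_prod_within.
rewrite withinS => /orP[/IH[T TS /sub_case/andP[cT wT]]|].
  by exists T => //; rewrite ltnS cT withinS wT orbT.
case/exists_inP=> s sS h.
have [y yE [T TS hT]] : exists2 y, (y == s^-1 * x)%g || (y == s * x)%g &
    exists2 T : {set gT}, T \subset S & signed_prod k T y || (#|T| < k) && within T k 1%g y.
  by case/orP: h => /IH hT; [exists (s^-1 * x)%g | exists (s * x)%g];
    rewrite ?eqxx ?orbT.
have sTS : s |: T \subset S by rewrite subUset sub1set sS.
have wsT : within (s |: T) k.+1 1%g x.
  rewrite withinS; apply/orP; right; apply/exists_inP; exists s; first exact: setU11.
  case/sub_case/andP: hT => _ /(within_subset (subsetUr [set s] T)).
  by case/orP: yE => /eqP-> ->; rewrite ?orbT.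
exists (s |: T) => //; rewrite wsT andbT cardsU1.
(* A repeated generator leaves at most [k] elements for [k.+1] steps, which is the second
   alternative. *)
case sT: (s \in T); first by case/sub_case/andP: hT => cT _; rewrite add0n ltnS cT orbT.
case/orP: hT => [hT|/andP[cT _]]; last by rewrite add1n ltnS cT orbT.
apply/orP; left; rewrite signed_prodS; apply/exists_inP.
exists s; first exact: setU11.
by rewrite setU1K ?sT //; case/orP: yE => /eqP<-; rewrite hT ?orbT.
Qed.

(** Each step has at most [2 * #|S| + 1] choices: stay, or multiply by a generator or an inverse. *)
Lemma card_ball S k : #|[set x | within S k 1%g x]| <= (2 * #|S| + 1) ^ k.
Proof.
elim: k => [|k IH].
  rewrite expn0 -(cards1 (1%g : gT)); apply: subset_leq_card.
  by apply/subsetP => x; rewrite !inE eq_sym.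
set B := [set x | within S k 1%g x] in IH.
pose C := B :|: [set (s * b)%g | s in S, b in B] :|: [set (s^-1 * b)%g | s in S, b in B].
apply: (@leq_trans #|C|).
  apply: subset_leq_card; apply/subsetP => x; rewrite inE withinS !inE.
  case/orP=> [->//|/exists_inP[s sS /orP[]h]].
    apply/orP; left; apply/orP; right; apply/imset2P.
    by exists s (s^-1 * x)%g; rewrite ?inE ?mulKVg.
  apply/orP; right; apply/imset2P.
  by exists s (s * x)%g; rewrite ?inE ?mulKg.
apply: leq_trans (_ : #|B| + #|S| * #|B| + #|S| * #|B| <= _).
  apply: leq_trans (leq_card_setU _ _) _; apply: leq_add.
    apply: leq_trans (leq_card_setU _ _) _; rewrite leq_add2l.
    by rewrite curry_imset2X -cardsX; exact: leq_imset_card.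
  by rewrite curry_imset2X -cardsX; exact: leq_imset_card.
rewrite expnS; nia.
Qed.

Hypothesis abG : abelian [set: gT].

Lemma mulC_abelian x y : (x * y = y * x)%g.
Proof. by apply: (centsP abG); rewrite inE. Qed.

(** By commutativity the factors may be reordered, so any chosen [t] can come first. *)
Lemma signed_prod_remove k T x t : t \in T -> signed_prod k.+1 T x ->
  signed_prod k (T :\ t) (t^-1 * x)%g || signed_prod k (T :\ t) (t * x)%g.
Proof.
elim: k T x t => [|k IH] T x t tT /exists_inP[s sT h].
  case: (eqVneq s t) h => [->//|st].
  by rewrite /= => /orP[]/andP[/eqP/setP/(_ t)]; rewrite !inE tT eq_sym st.
case: (eqVneq s t) h => [->//|st] h.
have tTs : t \in T :\ s by rewrite !inE eq_sym st.
have sTt : s \in T :\ t by rewrite !inE st.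
have C3 a b : (a * (b * x) = b * (a * x))%g by rewrite !mulgA (mulC_abelian a).
have TC : T :\ s :\ t = T :\ t :\ s by apply/setP=> z; rewrite !inE andbCA.
have {h} : (signed_prod k (T :\ t :\ s) (s^-1 * (t^-1 * x))%g
      || signed_prod k (T :\ t :\ s) (s * (t^-1 * x))%g)
   || (signed_prod k (T :\ t :\ s) (s^-1 * (t * x))%g
      || signed_prod k (T :\ t :\ s) (s * (t * x))%g).
  by rewrite -TC !(C3 s) !(C3 s^-1)%g; case/orP: h => /(IH _ _ _ tTs)/orP[]->;
    rewrite ?orbT.
by case/orP=> h; apply/orP; [left|right]; rewrite signed_prodS;
  apply/exists_inP; exists s.
Qed.

(** In an abelian group the product depends only on the choice of signs. *)
Lemma card_signed_prods k T : #|[set x | signed_prod k T x]| <= 2 ^ k.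
Proof.
elim: k T => [|k IH] T.
  rewrite expn0 -(cards1 (1%g : gT)); apply: subset_leq_card.
  by apply/subsetP => x; rewrite !inE => /andP[].
have [->|[t tT]] := set_0Vmem T.
  rewrite (_ : [set _ | _] = set0) ?cards0 //; apply/setP => x; rewrite !inE.
  by apply/exists_inP => -[t]; rewrite inE.
pose B := [set x | signed_prod k (T :\ t) x].
apply: (@leq_trans #|[set (t * b)%g | b in B] :|: [set (t^-1 * b)%g | b in B]|).
  apply: subset_leq_card; apply/subsetP => x; rewrite !inE => /(signed_prod_remove tT).
  case/orP=> h; apply/orP; [left|right]; apply/imsetP.
    by exists (t^-1 * x)%g; rewrite ?inE ?mulKVg.
  by exists (t * x)%g; rewrite ?inE ?mulKg.
apply: leq_trans (leq_card_setU _ _) _; rewrite expnS mul2n -addnn.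
by apply: leq_add; apply: leq_trans (leq_imset_card _ _) (IH _).
Qed.

(** Up to its sign, [t] is the quotient of [x] by one of the at most [2 ^ k] signed products of
    [T]. *)
Lemma card_signed_prod_extend k T x :
  #|[set t in ~: T | signed_prod k.+1 (t |: T) x]| <= 2 ^ k.+1.
Proof.
pose B := [set y | signed_prod k T y].
apply: (@leq_trans #|[set (x * b^-1)%g | b in B] :|: [set (b * x^-1)%g | b in B]|).
  apply: subset_leq_card; apply/subsetP => t; rewrite !inE => /andP[tT].
  move/(signed_prod_remove (setU11 t T)); rewrite setU1K //.
  case/orP=> h; apply/orP; [left|right]; apply/imsetP.
    exists (t^-1 * x)%g; rewrite ?inE //.
    by rewrite invMg invgK mulgA mulgV mul1g.
  by exists (t * x)%g; rewrite ?inE // mulgK.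
apply: leq_trans (leq_card_setU _ _) _; rewrite expnS mul2n -addnn.
by apply: leq_add; apply: leq_trans (leq_imset_card _ _) (card_signed_prods _ _).
Qed.
End SignedProducts.

(** * Second moment and counting *)

Section SecondMoment.
Variables (R : realType) (X I : finType) (p : R).
Hypothesis p01 : 0 <= p <= 1.
Local Notation mean := (subset_mean p).

(** Chebyshev's inequality for the number [Y] of [i] in [A] with [u i S]. A bad pair is bounded by
    the probability of its first event alone, so all bad pairs together add at most [B * mu] to the
    second moment. *)
Lemma second_moment (A : {set I}) (u : I -> {set X} -> bool) (bad : rel I)
    (mu kap B : R) :
  mu = \sum_(i in A) mean (fun S => (u i S)%:R) -> 0 < mu -> 0 <= kap ->
  (forall i j, i \in A -> j \in A -> ~~ bad i j ->
     mean (fun S => (u i S && u j S)%:R) <=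
     (1 + kap) * (mean (fun S => (u i S)%:R) * mean (fun S => (u j S)%:R))) ->
  (forall i, i \in A -> #|[set j in A | bad i j]|%:R <= B) ->
  mean (fun S => [forall i in A, ~~ u i S]%:R) <= kap + B / mu.
Proof.
move=> muE mu0 kap0 good badB.
pose a i := mean (fun S => (u i S)%:R).
have a0 i : 0 <= a i by apply: subset_mean_ge0.
pose Y (S : {set X}) : R := \sum_(i in A) (u i S)%:R.
have EY : mean Y = mu by rewrite subset_mean_sum muE.
have EY2 : mean (fun S => Y S * Y S) <= (1 + kap) * mu ^+ 2 + B * mu.
  have -> : mean (fun S => Y S * Y S) =
      \sum_(i in A) \sum_(j in A) mean (fun S => (u i S && u j S)%:R).
    rewrite (@eq_subset_mean _ _ p _ (fun S =>
        \sum_(i in A) \sum_(j in A) (u i S && u j S)%:R)).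
      by rewrite subset_mean_sum; apply: eq_bigr => i _; rewrite subset_mean_sum.
    move=> S; rewrite /Y mulr_suml; apply: eq_bigr => i _; rewrite mulr_sumr.
    by apply: eq_bigr => j _; rewrite -natrM mulnb.
  have -> : (1 + kap) * mu ^+ 2 + B * mu =
      \sum_(i in A) ((\sum_(j in A) (1 + kap) * (a i * a j)) + B * a i).
    rewrite big_split /= -mulr_sumr -muE; congr (_ + _).
    rewrite expr2 {1}muE mulr_suml mulr_sumr; apply: eq_bigr => i _.
    by rewrite -!mulr_sumr -muE.
  apply: ler_sum => i iA.
  apply: le_trans (_ : _ <= \sum_(j in A)
     ((1 + kap) * (a i * a j) + (bad i j)%:R * a i)) _.
    apply: ler_sum => j jA; case b: (bad i j); last first.
      by rewrite mul0r addr0 good ?b.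
    rewrite mul1r ler_wpDl ?mulr_ge0 ?addr_ge0 //.
    apply: le_subset_mean => // S; rewrite ler_nat.
    by case: (u i S); case: (u j S).
  rewrite big_split /= lerD2l -mulr_suml ler_wpM2r //.
  apply: le_trans (badB i iA); rewrite -sum1_card natr_sum.
  rewrite le_eqVlt; apply/orP; left; apply/eqP.
  rewrite [RHS]big_mkcond [LHS]big_mkcond; apply: eq_bigr => j _.
  by rewrite inE; case: (j \in A) => //=; case: (bad i j).
(* The indicator of [Y = 0] is at most [(Y / mu - 1) ^+ 2], expanded here so that linearity
   applies. *)
apply: le_trans (_ : _ <= mean (fun S =>
    mu^-1 ^+ 2 * (Y S * Y S) + (- 2 * mu^-1 * Y S + 1))) _.
  apply: le_subset_mean => // S; case: forallP => [h|_] /=.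
    have -> : Y S = 0; last by rewrite !mulr0 !add0r.
    by apply: big1 => i iA; move: (h i); rewrite iA /= => /negbTE->.
  have -> : mu^-1 ^+ 2 * (Y S * Y S) + (- 2 * mu^-1 * Y S + 1) =
    (mu^-1 * Y S - 1) ^+ 2 by ring.
  exact: sqr_ge0.
rewrite !subset_meanD !subset_meanZ subset_mean1 EY.
have mu00 : mu != 0 by rewrite gt_eqF.
have -> : kap + B / mu =
  mu^-1 ^+ 2 * ((1 + kap) * mu ^+ 2 + B * mu) + (- 2 * mu^-1 * mu + 1).
  by field.
by rewrite lerD2r ler_wpM2l // exprn_ge0 // invr_ge0 ltW.
Qed.
End SecondMoment.

(** * Counting main sets, small sets and overlapping pairs *)

Section Counting.
Variables (R : realType) (gT : finGroupType) (p : R).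
Hypothesis p01 : 0 <= p <= 1.
Implicit Types (S T L : {set gT}) (x y t : gT).
Local Notation N := #|gT|.

Definition main_sets d x := [set T : {set gT} | signed_prod d T x].
Definition small_sets d x :=
  [set T : {set gT} | (#|T| < d)%N && within T d 1%g x].
(** The expected number of subsets of the random set that have at most [m] elements. *)
Definition small_weight m : R := \sum_(L : {set gT} | (#|L| <= m)%N) p ^+ #|L|.

Let p0 : 0 <= p. Proof. by case/andP: p01. Qed.

Lemma small_weight_ge0 m : 0 <= small_weight m.
Proof. by apply: sumr_ge0 => L _; rewrite exprn_ge0. Qed.

Lemma sum_sets_card k : \sum_(L : {set gT} | #|L| == k) p ^+ #|L| =
  'C(N, k)%:R * p ^+ k.
Proof.
rewrite (eq_bigr (fun=> p ^+ k)) => [|L /eqP->//].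
rewrite sumr_const mulr_natl -card_draws; congr (_ *+ _).
by apply: eq_card => L; rewrite !inE.
Qed.

Lemma fact_bin_le k : (k`! * 'C(N, k) <= N ^ k)%N.
Proof.
rewrite mulnC bin_ffact; elim: k => [|k IH]; first by rewrite ffactn0.
by rewrite ffactnSr expnSr leq_mul // leq_subr.
Qed.

(** Each size [k <= m] contributes at most [P ^+ k]. As [N * p] may be below 1, a bound [P >= 1]
    replaces it, so that the largest power dominates. *)
Lemma small_weight_le (P : R) m : N%:R * p <= P -> 1 <= P ->
  small_weight m <= m.+1%:R * P ^+ m.
Proof.
move=> NpP P1; have P0 : 0 <= P by lra.
have binle k : 'C(N, k)%:R * p ^+ k <= P ^+ k.
  apply: le_trans (_ : (N%:R * p) ^+ k <= _); last first.
    by rewrite lerXn2r // nnegrE ?mulr_ge0.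
  rewrite exprMn ler_wpM2r ?exprn_ge0 // -natrX ler_nat.
  by apply: leq_trans (fact_bin_le k); rewrite leq_pmull ?fact_gt0.
elim: m => [|m IH].
  rewrite /small_weight (eq_bigl (fun L => #|L| == 0%N)) => [|L].
    by rewrite sum_sets_card (le_trans (binle _)) // mul1r.
  by rewrite leqn0.
rewrite /small_weight (bigID (fun L => #|L| == m.+1)) /=.
rewrite (eq_bigl (fun L => #|L| == m.+1)) => [|L]; last first.
  by case: eqP => [->|]; rewrite ?leqnn ?andbF.
rewrite [X in _ + X](eq_bigl (fun L => #|L| <= m)%N) => [|L]; last first.
  by rewrite andbC -ltn_neqAle ltnS.
rewrite sum_sets_card -/(small_weight m) -[in leRHS]natr1 mulrDl mul1r addrC.
apply: lerD (binle _); apply: le_trans IH _; rewrite ler_wpM2l //.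
by rewrite ler_weXn2l.
Qed.

(** Exchange the sums: by [card_ball], a set of fewer than [d] elements reaches at most
    [(2 * d) ^ d] points within [d] steps. *)
Lemma sum_small_sets d : (0 < d)%N ->
  \sum_x \sum_(T in small_sets d x) p ^+ #|T| <=
  (2 * d)%:R ^+ d * small_weight d.-1.
Proof.
case: d => // d _; rewrite (exchange_big_dep xpredT) //= mulr_sumr.
rewrite [leRHS]big_mkcond; apply: ler_sum => T _; case: ifP => [cT|/negbT cT].
  rewrite sumr_const -[leLHS]mulr_natl ler_wpM2r ?exprn_ge0 // -natrX ler_nat.
  apply: leq_trans (_ : (2 * #|T| + 1) ^ d.+1 <= _)%N; last by rewrite leq_exp2r //; lia.
  apply: leq_trans (card_ball T d.+1); apply: subset_leq_card.
  apply/subsetP => x; rewrite unfold_in => h; rewrite inE.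
  by have : T \in small_sets d.+1 x := h; rewrite inE => /andP[].
rewrite big_pred0 // => x; rewrite inE ltnS (negbTE cT) //.
Qed.

(** Group by the intersection with [T], which has at most [2 ^ #|T|] values. Given it, [T0] is
    determined by [T0 :\: T], and this has at most [k] elements because [T0] meets [T]. *)
Lemma sum_meeting_sets T k : \sum_(T0 : {set gT} | (#|T0| == k.+1) && ~~ [disjoint T & T0])
   p ^+ #|T0 :\: T| <= 2 ^+ #|T| * small_weight k.
Proof.
rewrite (partition_big (fun T0 => T0 :&: T) (fun K => K \in powerset T)) /=; last first.
  by move=> T0 _; rewrite inE subsetIr.
have -> : 2 ^+ #|T| * small_weight k = \sum_(K in powerset T) small_weight k.
  by rewrite sumr_const card_powerset -[RHS]mulr_natl natrX.
apply: ler_sum => K _.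
pose A := [set T0 : {set gT} | (#|T0| == k.+1) && ~~ [disjoint T & T0] && (T0 :&: T == K)].
have injA : {in A &, injective (fun T0 => T0 :\: T)}.
  move=> T1 T2; rewrite !inE => /andP[_ /eqP e1] /andP[_ /eqP e2] e.
  by rewrite -(setID T1 T) -(setID T2 T) e e1 e2.
rewrite (eq_bigl (fun T0 => T0 \in A)) => [|T0]; last by rewrite inE.
rewrite -(big_imset (fun L => p ^+ #|L|) injA) /= /small_weight.
rewrite [leRHS](bigID (mem [set T0 :\: T | T0 in A])) /=.
rewrite -[leLHS]addr0; apply: lerD; last by apply: sumr_ge0 => L _; rewrite exprn_ge0.
rewrite [leRHS](eq_bigl (mem [set T0 :\: T | T0 in A])) // => L.
apply: andb_idl => /imsetP[T0]; rewrite !inE => /andP[/andP[/eqP cT0 meet] _] ->.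
rewrite -ltnS -cT0 -(cardsID T T0) -[X in (X < _)%N]add0n ltn_add2r.
by rewrite card_gt0 setI_eq0 disjoint_sym.
Qed.

Hypothesis abG : abelian [set: gT].

(** Delete one of the [d] elements of a main set. What remains is one of the sets of size [d - 1],
    and each of them extends to a main set of [x] in at most [2 ^ d] ways. *)
Lemma card_main_sets d x : (0 < d)%N ->
  (d`!)%:R * #|main_sets d x|%:R <= 2 ^+ d * N%:R ^+ d.-1 :> R.
Proof.
case: d => // k _; set M := main_sets _ _.
have : k.+1%:R * #|M|%:R <= 2 ^+ k.+1 * 'C(N, k)%:R :> R.
  have -> : k.+1%:R * #|M|%:R =
      \sum_(T : {set gT}) \sum_(t in T) (T \in M)%:R :> R.
    rewrite mulrC mulr_natl -sumr_const big_mkcond /=; apply: eq_bigr => T _.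
    rewrite sumr_const; case: ifP => [|_]; last by rewrite mul0rn.
    by rewrite inE => /signed_prod_card ->.
  rewrite sum_pointed_sets.
  apply: le_trans (_ : _ <= \sum_(T : {set gT} | #|T| == k) 2 ^+ k.+1) _.
    rewrite [leRHS]big_mkcond; apply: ler_sum => T _.
    have -> : \sum_(t in ~: T) (t |: T \in M)%:R =
        #|[set t in ~: T | signed_prod k.+1 (t |: T) x]|%:R :> R.
      rewrite -sum1_card natr_sum big_mkcond [RHS]big_mkcond.
      apply: eq_bigr => t _; rewrite /M !inE; case: (t \in T) => //.
      by case: (signed_prod _ _ _).
    case: ifP => [_|/eqP cT].
      by rewrite -natrX ler_nat card_signed_prod_extend.
    rewrite (_ : [set _ | _] = set0) ?cards0 //; apply/setP=> t; rewrite !inE.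
    case tT: (t \in T) => //; case sp: (signed_prod _ _ _) => //.
    by move/signed_prod_card: sp; rewrite cardsU1 tT => -[].
  rewrite sumr_const -[leLHS]mulr_natr -card_draws ler_wpM2l ?exprn_ge0 //.
  by rewrite ler_nat; apply/eq_leq/eq_card => T; rewrite !inE.
move=> h; rewrite factS mulnC natrM -mulrA.
apply: le_trans (ler_wpM2l (ler0n _ _) h) _.
rewrite mulrCA ler_wpM2l ?exprn_ge0 // -natrM -natrX ler_nat.
exact: fact_bin_le.
Qed.

(** Since [T'] has the size of [T] and differs from it, some [t] in [T'] lies outside [T]. Removing
    it gives the factor [p], at most [2 ^ d] choices of [t], and a set of size [d - 1] that still
    meets [T], to which [sum_meeting_sets] applies. *)
Lemma sum_meeting_main_sets d T v : (1 < d)%N -> #|T| = d ->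
  \sum_(T' in main_sets d v | (T' != T) && ~~ [disjoint T & T']) p ^+ #|T :|: T'|
  <= p ^+ d * (4 ^+ d * p * small_weight d.-2).
Proof.
case: d => [|[|k]] // _ cT; set M := main_sets _ _.
have U (T' : {set gT}) : #|T :|: T'| = (#|T| + #|T' :\: T|)%N.
  by rewrite -(cardsID T) setUK setDUl setDv set0U.
rewrite (eq_bigr (fun T' => p ^+ k.+2 * p ^+ #|T' :\: T|)); last first.
  by move=> T' _; rewrite U cT exprD.
rewrite -mulr_sumr ler_wpM2l ?exprn_ge0 //.
pose c (T' : {set gT}) t : R := (T' \in M)%:R * (~~ [disjoint T & T'])%:R * (t \notin T)%:R
                   * p ^+ #|T' :\: T|.
have c0 T' t : 0 <= c T' t by rewrite /c !mulr_ge0 ?exprn_ge0.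
apply: le_trans (_ : _ <= \sum_(T' : {set gT}) \sum_(t in T') c T' t) _.
  rewrite [leLHS]big_mkcond; apply: ler_sum => T' _; case: ifP => [|_]; last first.
    exact: sumr_ge0.
  case/and3P=> T'M T'T meet.
  have [t tT' tT] : exists2 t, t \in T' & t \notin T.
    apply/subsetPn; apply: contra T'T => sub; rewrite eqEcard sub cT.
    by move: T'M; rewrite inE => /signed_prod_card ->; rewrite leqnn.
  rewrite (bigD1 t) //= {1}/c T'M meet tT !mul1r lerDl.
  exact: sumr_ge0.
rewrite sum_pointed_sets.
apply: le_trans (_ : _ <= \sum_(T0 : {set gT} | (#|T0| == k.+1) && ~~ [disjoint T & T0])
   2 ^+ k.+2 * p * p ^+ #|T0 :\: T|) _; last first.
  rewrite -mulr_sumr.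
  apply: le_trans (_ : _ <= 2 ^+ k.+2 * p * (2 ^+ #|T| * small_weight k)) _.
    apply: ler_wpM2l; first by rewrite mulr_ge0 ?exprn_ge0.
    exact: sum_meeting_sets.
  have -> : 4 ^+ k.+2 = 2 ^+ k.+2 * 2 ^+ k.+2 :> R by rewrite -exprMn -natrM.
  by rewrite cT le_eqVlt; apply/orP; left; apply/eqP; ring.
rewrite [leRHS]big_mkcond; apply: ler_sum => T0 _.
apply: le_trans (_ : _ <= \sum_(t in [set t in ~: T0 | signed_prod k.+2 (t |: T0) v])
   ((#|T0| == k.+1) && ~~ [disjoint T & T0])%:R * (p * p ^+ #|T0 :\: T|)) _.
  rewrite big_mkcond [leRHS]big_mkcond; apply: ler_sum => t _.
  rewrite !inE; case tT0: (t \in T0) => //.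
  rewrite /c inE; case sp: (signed_prod _ _ _); last by rewrite !mul0r.
  have -> /= : #|T0| == k.+1.
    by move/signed_prod_card: sp; rewrite cardsU1 tT0 add1n => -[->].
  case tT: (t \in T); first by rewrite /= mulr0 mul0r !mulr_ge0 ?exprn_ge0.
  rewrite mul1r mulr1 /=.
  have -> : [disjoint T & t |: T0] = [disjoint T & T0].
    by rewrite -!setI_eq0 setIUr (_ : T :&: [set t] = set0) ?set0U //; apply/eqP;
      rewrite setI_eq0 disjoint_sym disjoints1 tT.
  have -> : (t |: T0) :\: T = t |: (T0 :\: T).
    apply/setP=> z; rewrite !inE; case: (eqVneq z t) => // ->; by rewrite tT.
  by rewrite cardsU1 !inE tT0 andbF exprD expr1.
rewrite sumr_const; case: ifP => _; last by rewrite mul0r mul0rn.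
rewrite mul1r -[leLHS]mulr_natl -[leRHS]mulrA.
apply: ler_wpM2r; first by rewrite mulr_ge0 ?exprn_ge0.
by rewrite -natrX ler_nat card_signed_prod_extend.
Qed.

(** Each main set of [x] is a main set of at most [2 ^ d] points [y]. *)
Lemma sum_common_main_sets d x :
  \sum_y #|main_sets d x :&: main_sets d y|%:R <= 2 ^+ d * #|main_sets d x|%:R :> R.
Proof.
have -> : \sum_y #|main_sets d x :&: main_sets d y|%:R =
    \sum_(T in main_sets d x) #|[set y | signed_prod d T y]|%:R :> R.
  under eq_bigr => y _ do rewrite -sum1_card natr_sum big_mkcond.
  under [RHS]eq_bigr => T _ do rewrite -sum1_card natr_sum big_mkcond.
  rewrite [RHS]big_mkcond exchange_big; apply: eq_bigr => T _ /=.
  case TM: (T \in _).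
    by apply: eq_bigr => y _; rewrite in_setI TM !inE.
  by rewrite big1 // => y _; rewrite in_setI TM.
rewrite mulr_natr -sumr_const; apply: ler_sum => T _.
by rewrite -natrX ler_nat card_signed_prods.
Qed.

End Counting.

(** * Uncovered elements *)

Lemma prod_1B_ge (R : realType) (I : eqType) (r : seq I) (a : I -> R) :
  (forall i, i \in r -> 0 <= a i <= 1) ->
  1 - \sum_(i <- r) a i <= \prod_(i <- r) (1 - a i).
Proof.
elim: r => [|i r IH] a01; first by rewrite !big_nil subr0.
have /andP[ai0 ai1] : 0 <= a i <= 1 by apply: a01; rewrite mem_head.
have a01' j : j \in r -> 0 <= a j <= 1 by move=> jr; apply: a01; rewrite inE jr orbT.
have s0 : 0 <= \sum_(j <- r) a j.
  by rewrite big_seq sumr_ge0 // => j /a01'/andP[].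
rewrite !big_cons; apply: le_trans (_ : (1 - a i) * (1 - \sum_(j <- r) a j) <= _).
  by rewrite mulrBl !mulrBr !mul1r !mulr1; have := mulr_ge0 ai0 s0; lra.
by apply: ler_wpM2l (IH a01'); rewrite subr_ge0.
Qed.

Lemma bernoulli_1B (R : realType) (u : R) m :
  0 <= u <= 1 -> 1 - m%:R * u <= (1 - u) ^+ m.
Proof.
case/andP=> u0 u1; elim: m => [|m IH]; first by rewrite mul0r subr0.
rewrite exprS; apply: le_trans (_ : (1 - u) * (1 - m%:R * u) <= _).
  by rewrite -natr1; have := mulr_ge0 (mulr_ge0 (ler0n R m) u0) u0; nra.
by rewrite ler_wpM2l // subr_ge0.
Qed.

(** Four factors [1 - eta] are lost: one for the Janson correction [C], one for the [c] main sets
    counted twice in [mx + my], and one in each of the lower bounds on [ax] and [ay]. *)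
Lemma pair_estimate (R : realType) (q C lam eta axy ax ay : R) (mx my m c : nat) :
  0 <= q -> q <= 2^-1 -> 0 <= C -> 0 < eta -> eta <= 8^-1 ->
  (m + c = mx + my)%N -> 0 <= axy -> 4 * C * lam <= eta ->
  q * mx%:R <= lam -> q * my%:R <= lam -> q * c%:R <= eta ->
  axy <= (1 - q + q * C) ^+ m ->
  (1 - q) ^+ mx * (1 - eta) <= ax -> (1 - q) ^+ my * (1 - eta) <= ay ->
  axy <= (1 + 8 * eta) * (ax * ay).
Proof.
move=> q0 q_le C0 eta_gt0 eta_le mE axy0 C_le mxq myq cq axy_le ax_ge ay_ge.
have mq : q * m%:R <= 2 * lam.
  have : q * m%:R <= q * (mx + my)%:R by rewrite ler_wpM2l // ler_nat -mE leq_addr.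
  by rewrite natrD mulrDr; lra.
(* Chosen so that [(1 - q + q * C) * (1 - u) <= 1 - q], which holds as [q <= 1/2]. *)
set u := 2 * (q * C).
have u0 : 0 <= u by rewrite !mulr_ge0.
have mu : m%:R * u <= eta.
  have -> : m%:R * u = 2 * C * (q * m%:R) by rewrite /u; ring.
  apply: le_trans (_ : 2 * C * (2 * lam) <= _).
    by rewrite ler_wpM2l // mulr_ge0.
  by lra.
have pw0 n : 0 <= (1 - q) ^+ n by rewrite exprn_ge0 //; lra.
have eta1 : 0 <= 1 - eta by lra.
have step1 : axy * (1 - eta) <= (1 - q) ^+ m.
  (* Only for [m > 0] does [m * u <= eta] give [u <= 1]. *)
  case: (posnP m) => m0; first by move: axy_le; rewrite m0 !expr0; nra.
  have u1 : u <= 1.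
    have : 1 * u <= m%:R * u by rewrite ler_wpM2r // ler1n.
    by lra.
  apply: le_trans (_ : (1 - q + q * C) ^+ m * (1 - u) ^+ m <= _).
    apply: ler_pM => //.
    by apply: le_trans (bernoulli_1B m _); rewrite ?u0 // lerB.
  have qC0 : 0 <= q * C by rewrite mulr_ge0.
  have h : 0 <= q * C * (1 - 2 * q) by rewrite mulr_ge0 //; lra.
  have h2 : 0 <= (q * C) ^+ 2 by exact: sqr_ge0.
  rewrite -exprMn lerXn2r ?nnegrE //.
  - by rewrite mulr_ge0 //; lra.
  - by lra.
  by rewrite /u; move: h h2; rewrite expr2; lra.
have step2 : (1 - q) ^+ m * (1 - eta) <= (1 - q) ^+ mx * (1 - q) ^+ my.
  rewrite -exprD -mE exprD ler_wpM2l //.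
  apply: le_trans (bernoulli_1B _ _); last by apply/andP; split; lra.
  by rewrite lerB // mulrC.
have step3 : (1 - q) ^+ mx * (1 - q) ^+ my * (1 - eta) ^+ 2 <= ax * ay.
  have -> : (1 - q) ^+ mx * (1 - q) ^+ my * (1 - eta) ^+ 2 =
    ((1 - q) ^+ mx * (1 - eta)) * ((1 - q) ^+ my * (1 - eta)) by ring.
  by apply: ler_pM; rewrite ?mulr_ge0.
have step4 : axy * (1 - eta) ^+ 4 <= ax * ay.
  apply: le_trans step3; apply: le_trans (ler_wpM2r _ step2); rewrite ?sqr_ge0 //.
  rewrite (_ : axy * _ = axy * (1 - eta) * (1 - eta) ^+ 3); last by ring.
  rewrite (_ : _ * _ * (1 - eta) ^+ 2 = (1 - q) ^+ m * (1 - eta) ^+ 3); last by ring.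
  by rewrite ler_wpM2r // exprn_ge0.
apply: le_trans (ler_wpM2l _ step4); last by lra.
(* Here [eta <= 1/8] enters: [(1 + 8 * eta) * (1 - 4 * eta) = 1 + 4 * eta * (1 - 8 * eta)]. *)
have e4 : 1 <= (1 + 8 * eta) * (1 - eta) ^+ 4.
  apply: le_trans (_ : (1 + 8 * eta) * (1 - 4 * eta) <= _); first by nra.
  rewrite ler_wpM2l //; first lra.
  by apply: bernoulli_1B; apply/andP; split; lra.
by rewrite mulrCA -{1}[axy]mulr1 ler_wpM2l.
Qed.

Section Uncovered.
Variables (R : realType) (gT : finGroupType) (p : R) (d : nat).
Hypothesis abG : abelian [set: gT].
Hypothesis p01 : 0 <= p <= 1.
Hypothesis d_gt1 : (1 < d)%N.
Implicit Types (S T : {set gT}) (x y : gT).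
Local Notation N := #|gT|.
Local Notation mean := (subset_mean p).
Local Notation main := (main_sets d).
Local Notation q := (p ^+ d).

Definition uncovered x S := ~~ within S d 1%g x.
Definition uncovered_prob x : R := mean (fun S => (uncovered x S)%:R).

Let p0 : 0 <= p. Proof. by case/andP: p01. Qed.
Let p1 : p <= 1. Proof. by case/andP: p01. Qed.

Lemma avoids_uncovered x S :
  avoids (enum (main x) ++ enum (small_sets d x)) S -> uncovered x S.
Proof.
move/allP=> av; apply/negP => /within_support[T TS hT].
have : T \in enum (main x) ++ enum (small_sets d x).
  by rewrite mem_cat !mem_enum !inE.
by move/av; rewrite TS.
Qed.

Lemma uncovered_avoids x S : uncovered x S -> avoids (enum (main x)) S.
Proof.
move=> unc; apply/allP => T; rewrite mem_enum inE => /signed_prod_within wT.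
by apply: contra unc => TS; exact: within_subset wT.
Qed.

(** Harris' inequality for main and small sets together; the factors of the small sets are then
    reduced to a union bound. *)
Lemma uncovered_prob_ge x :
  (1 - q) ^+ #|main x| * (1 - \sum_(T in small_sets d x) p ^+ #|T|)
  <= uncovered_prob x.
Proof.
apply: le_trans (_ : avoid_prob p (enum (main x) ++ enum (small_sets d x)) <= _).
  apply: le_trans (avoid_prob_ge p01 _); rewrite big_cat /= !big_enum /=.
  rewrite -[X in _ <= X * _](_ : (1 - q) ^+ #|main x| = _); last first.
    rewrite -prodr_const; apply: eq_bigr => T.
    by rewrite inE => /signed_prod_card ->.
  rewrite ler_wpM2l ?exprn_ge0 ?subr_ge0 ?exprn_ile1 //.
  rewrite -!big_enum; apply: prod_1B_ge => T _.
  by rewrite exprn_ge0 // exprn_ile1.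
apply: le_subset_mean => // S; rewrite ler_nat.
by have := @avoids_uncovered x S; case: (avoids _ S) => // ->.
Qed.

(** Janson's inequality for the main sets of both points. A set meets main sets of [x] and of [y],
    whence the factor 2 in the correction. *)
Lemma uncovered_pair_le x y :
  mean (fun S => (uncovered x S && uncovered y S)%:R) <=
  (1 - q + q * (2 * 4 ^+ d * p * small_weight gT p d.-2)) ^+ #|main x :|: main y|.
Proof.
set c := q * _.
apply: le_trans (_ : avoid_prob p (enum (main x :|: main y)) <= _).
  apply: le_subset_mean => // S; rewrite ler_nat.
  case unc: (uncovered x S && uncovered y S) => //.
  rewrite (_ : avoids _ _) //; apply/allP => T; rewrite mem_enum inE.
  case/andP: unc => /uncovered_avoids/allP hx /uncovered_avoids/allP hy.
  by case/orP=> h; [apply: hx | apply: hy]; rewrite mem_enum.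
rewrite cardE; apply: avoid_prob_le => //; first exact: enum_uniq.
  by move=> T; rewrite mem_enum !inE => /orP[]/signed_prod_card.
move=> T; rewrite mem_enum => TM.
have cT : #|T| = d by move: TM; rewrite !inE => /orP[]/signed_prod_card.
rewrite big_enum_cond /=.
pose g T' := (T' != T) && ~~ [disjoint T & T'].
have gE v : \sum_(T' in main v | g T') p ^+ #|T :|: T'| <=
    q * (4 ^+ d * p * small_weight gT p d.-2).
  exact: sum_meeting_main_sets.
apply: le_trans (_ : _ <= \sum_(T' in main x | g T') p ^+ #|T :|: T'| +
    \sum_(T' in main y | g T') p ^+ #|T :|: T'|) _.
  rewrite big_mkcond [X in _ <= X + _]big_mkcond [X in _ <= _ + X]big_mkcond.
  rewrite -big_split; apply: ler_sum => T' _ /=.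
  rewrite in_setU -/(g T'); have := exprn_ge0 #|T :|: T'| p0.
  by case: (T' \in main x); case: (T' \in main y); case: (g T') => /=; lra.
apply: le_trans (lerD (gE x) (gE y)) _.
by rewrite /c le_eqVlt; apply/orP; left; apply/eqP; ring.
Qed.

Variables (lam eta : R).
Hypothesis q_le : q <= 2^-1.
Hypothesis eta_gt0 : 0 < eta.
Hypothesis eta_le : eta <= 8^-1.
Hypothesis main_le : forall x, q * #|main x|%:R <= lam.
Hypothesis meet_le : 4 * (2 * 4 ^+ d * p * small_weight gT p d.-2) * lam <= eta.

(** Small sets are controlled only on average over [x], so the second moment is restricted to these
    points. *)
Definition good := [set x : gT | \sum_(T in small_sets d x) p ^+ #|T| <= eta].

Lemma uncovered_pair_good x y : x \in good -> y \in good ->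
  q * #|main x :&: main y|%:R <= eta ->
  mean (fun S => (uncovered x S && uncovered y S)%:R) <=
  (1 + 8 * eta) * (uncovered_prob x * uncovered_prob y).
Proof.
move=> gx gy capE.
have q0 : 0 <= q by rewrite exprn_ge0.
have q1 : q <= 1 by rewrite exprn_ile1.
have lower z : z \in good -> (1 - q) ^+ #|main z| * (1 - eta) <= uncovered_prob z.
  rewrite inE => gz; apply: le_trans (uncovered_prob_ge z).
  by apply: ler_wpM2l; [rewrite exprn_ge0 ?subr_ge0 | exact: lerB].
apply: (pair_estimate q0 q_le _ eta_gt0 eta_le _ _ meet_le
  (main_le x) (main_le y) capE (uncovered_pair_le x y) (lower x gx) (lower y gy)).
- by rewrite !mulr_ge0 ?exprn_ge0 ?small_weight_ge0.
- by rewrite cardsUI.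
exact: subset_mean_ge0.
Qed.

(** Markov's inequality applied to the sum in [sum_small_sets]. *)
Lemma card_good : (2 * d)%:R ^+ d * small_weight gT p d.-1 <= eta * (N%:R / 2) ->
  N%:R / 2 <= #|good|%:R :> R.
Proof.
move=> h; have := le_trans (sum_small_sets gT p01 (ltnW d_gt1)) h => {h}.
have -> : N%:R = #|good|%:R + #|~: good|%:R :> R by rewrite -natrD cardsC.
move=> h; suff : #|~: good|%:R * eta <= eta * ((#|good|%:R + #|~: good|%:R) / 2).
  by rewrite mulrC ler_pM2l //; lra.
apply: le_trans h; rewrite mulr_natl -sumr_const big_mkcond /=; apply: ler_sum => x _.
case: ifP => [|_]; last by apply: sumr_ge0 => T _; rewrite exprn_ge0.
by rewrite !inE -ltNge => /ltW.
Qed.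

Lemma diam_prob_le (a : R) : 0 < a ->
  (2 * d)%:R ^+ d * small_weight gT p d.-1 <= eta * (N%:R / 2) ->
  (forall x, a <= (1 - q) ^+ #|main x|) ->
  cayley_prob p (fun S : {set gT} => diam_le S d) <=
  8 * eta + (2 ^+ d * lam / eta) / (N%:R * a / 4).
Proof.
move=> a0 small_le a_le.
have q0 : 0 <= q by rewrite exprn_ge0.
have N0 : 0 < N%:R :> R by rewrite ltr0n; apply/card_gt0P; exists 1%g.
have lam0 : 0 <= lam by apply: le_trans (main_le 1%g); rewrite mulr_ge0.
have -> : cayley_prob p (fun S : {set gT} => diam_le S d) =
    mean (fun S => (diam_le S d)%:R).
  rewrite /cayley_prob big_mkcond; apply: eq_bigr => S _.
  by case: ifP; rewrite ?mulr1 ?mulr0.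
apply: le_trans (_ : mean (fun S => [forall x in good, ~~ uncovered x S]%:R) <= _).
  apply: le_subset_mean => // S; rewrite ler_nat.
  case dm: (diam_le S d) => //; rewrite (_ : [forall x in good, _]) //.
  apply/forall_inP => x _; rewrite negbK.
  by move/forallP: dm => /(_ 1%g)/forallP/(_ x).
pose mu : R := \sum_(x in good) uncovered_prob x.
(* At least [N / 2] points are good, and each is uncovered with probability at least
   [a * (1 - eta) >= a / 2]. *)
have muge : N%:R * a / 4 <= mu.
  apply: le_trans (_ : \sum_(x in good) (a / 2) <= _).
    rewrite sumr_const -[leRHS]mulr_natl.
    have := ler_wpM2r (ltW a0) (card_good small_le); lra.
  apply: ler_sum => x; rewrite inE => gx; apply: le_trans (uncovered_prob_ge x).
  apply: ler_pM; [exact: ltW | by rewrite invr_ge0 | exact: a_le |].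
  by apply: le_trans (lerB (lexx 1) gx); have := eta_le; lra.
have mu0 : 0 < mu by apply: lt_le_trans muge; rewrite divr_gt0 ?mulr_gt0.
apply: le_trans (_ : 8 * eta + (2 ^+ d * lam / eta) / mu <= _); last first.
  rewrite lerD2l; apply: ler_wpM2l.
    by rewrite divr_ge0 ?mulr_ge0 ?exprn_ge0 // ltW.
  by rewrite lef_pV2 ?posrE // divr_gt0 ?mulr_gt0.
apply: (second_moment p01 (bad := fun x y => eta < q * #|main x :&: main y|%:R)) => //.
- by rewrite mulr_ge0 // ltW.
- by move=> x y gx gy; rewrite -leNgt; exact: uncovered_pair_good.
(* Markov's inequality again: every bad [y] contributes more than [eta] to a sum over [y] that is at
   most [2 ^+ d * lam]. *)
move=> x gx; rewrite ler_pdivlMr //.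
apply: le_trans (_ : q * (2 ^+ d * #|main x|%:R) <= _); last first.
  by rewrite mulrCA ler_wpM2l ?exprn_ge0.
apply: le_trans (ler_wpM2l q0 (sum_common_main_sets R abG d x)).
rewrite mulr_natl -sumr_const big_mkcond mulr_sumr; apply: ler_sum => y _.
case: ifP; first by rewrite inE => /andP[_ /ltW].
by rewrite mulr_ge0.
Qed.
End Uncovered.

(** * Estimates at the threshold *)

Lemma fact_mul_le_expn d : (d * d`! <= d ^ d)%N.
Proof.
case: d => [//|d]; rewrite expnS leq_mul2l /=.
elim: d => [//|d IH]; rewrite factS expnS leq_mul //.
by apply: leq_trans IH _; case: d => // d; rewrite leq_exp2r.
Qed.

Lemma exists_root (R : realType) (d : nat) (b : R) : (0 < d)%N -> 0 <= b ->
  exists2 r : R, 0 <= r & r ^+ d = b.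
Proof.
move=> d0 b0; exists (b `^ (d%:R^-1)); first exact: powR_ge0.
by rewrite -powR_mulrn ?powR_ge0 // -powRrM mulVf ?powRr1 // pnatr_eq0 -lt0n.
Qed.

Lemma exponent_facts d : (1 < d)%N ->
  [/\ d + 4 <= 4 * d ^ 2, 3 * d - 2 + (d + 2) = 4 * d, 4 <= 3 * d - 2
    & d + 2 <= 3 * d - 2]%N.
Proof. by move=> d_gt1; split; rewrite ?expnS ?expn0; nia. Qed.

Section Estimates.
Variables (R : realType) (d : nat) (s n e : R).
Hypotheses (d_gt1 : (1 < d)%N) (s_ge : (2 * d)%:R <= s).
Hypotheses (n_ge : s ^+ (4 * d ^ 2) <= n) (e0 : 0 <= e) (e_le : e <= 2^-1).

(* [pbound_pow e d N] for [n = N] and [s = sqrt (log N)]. *)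
Definition threshold : R := (d`!)%:R * (1 - e) / 2 ^+ d * (s ^+ 2 / n ^+ d.-1).
Local Notation pb := threshold.

Let s_ge4 : 4 <= s.
Proof. by apply: le_trans s_ge; rewrite (ler_nat R 4) (leq_pmul2l (m := 2) (n1 := 2)). Qed.

Let s_ge1 : 1 <= s. Proof. by apply: le_trans s_ge4; rewrite (ler_nat R 1). Qed.
Let s_ge0 : 0 <= s. Proof. exact: le_trans s_ge1. Qed.

Let n_ge1 : 1 <= n.
Proof. by apply: le_trans n_ge; rewrite exprn_ege1. Qed.

Let n_gt0 : 0 < n. Proof. exact: lt_le_trans n_ge1. Qed.
Let n_ge0 : 0 <= n. Proof. exact: ltW. Qed.

Let e1 : 0 <= 1 - e.
Proof. by rewrite subr_ge0 (le_trans e_le) // invf_le1 // ler1n. Qed.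

Let d_le_s : (2 * d)%:R ^+ d <= s ^+ d.
Proof. by rewrite lerXn2r ?nnegrE. Qed.

Let fact_le : d%:R * (d`!)%:R * 2 ^+ d <= s ^+ d.
Proof.
apply: le_trans d_le_s; rewrite -!natrX -!natrM ler_nat.
by rewrite expnMn mulnC leq_mul2l fact_mul_le_expn orbT.
Qed.

Lemma threshold_ge0 : 0 <= pb.
Proof. by rewrite !mulr_ge0 ?invr_ge0 ?exprn_ge0. Qed.

(** Together with [card_main_sets] this bounds the expected number of main sets of a point by
    [(1 - e) * s ^+ 2]. *)
Lemma threshold_count :
  pb * (2 ^+ d * n ^+ d.-1) = (d`!)%:R * ((1 - e) * s ^+ 2).
Proof.
have nd : n ^+ d.-1 != 0 by rewrite expf_neq0 // gt_eqF.
have td : 2 ^+ d != 0 :> R by rewrite expf_neq0 ?pnatr_eq0.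
rewrite /threshold; move: nd td.
move: (n ^+ d.-1) (2 ^+ d : R) => a b a0 b0; field.
by rewrite a0 b0.
Qed.

Lemma threshold_le : pb * s ^+ 2 <= 1.
Proof.
rewrite -(ler_pM2r n_gt0) mul1r; apply: le_trans n_ge.
apply: le_trans (_ : s ^+ (d + 4) <= _); last first.
  by rewrite ler_weXn2l //; case: (exponent_facts d_gt1).
apply: le_trans (_ : pb * (2 ^+ d * n ^+ d.-1) * s ^+ 2 <= _).
  rewrite mulrAC ler_wpM2r ?exprn_ge0 // ler_wpM2l ?threshold_ge0 //.
  rewrite -[leLHS]mul1r; apply: ler_pM => //.
    by rewrite exprn_ege1 // ler1n.
  by rewrite -{1}(expr1 n) ler_weXn2l // -ltnS prednK // ltnW.
rewrite threshold_count exprD.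
rewrite (_ : _ * _ * s ^+ 2 = (d`!)%:R * (1 - e) * s ^+ 4); last by rewrite (exprD _ 2 2); ring.
rewrite ler_wpM2r ?exprn_ge0 //; apply: le_trans fact_le.
rewrite -mulrA mulrCA ler_wpM2l //.
apply: (@le_trans _ _ 1); first by rewrite lerBlDr lerDl.
rewrite -[leLHS]mul1r; apply: ler_pM => //; last by rewrite exprn_ege1 // ler1n.
by rewrite ler1n ltnW.
Qed.

Variable P : R.
Hypotheses (P0 : 0 <= P) (PE : P ^+ d = n ^+ d * pb).

Let PdE : P ^+ d * 2 ^+ d = n * ((d`!)%:R * ((1 - e) * s ^+ 2)).
Proof.
rewrite PE -threshold_count -[X in n ^+ X](prednK (ltnW d_gt1)) exprS; ring.
Qed.

(** [P] is [N * p] at the threshold. The [d]-th power of the claim follows from [n_ge], since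
    [(2 * P) ^+ d] is [n] times a factor at least 1. *)
Lemma power_le_2P : s ^+ (4 * d) <= 2 * P.
Proof.
rewrite -(@ler_pXn2r _ d) ?nnegrE ?exprn_ge0 ?mulr_ge0 ?(ltnW d_gt1) //.
rewrite -exprM exprMn mulrC PdE -[leLHS]mulr1.
rewrite (_ : (4 * d * d = 4 * d ^ 2)%N); last by rewrite -mulnA mulnn.
apply: ler_pM; rewrite ?exprn_ge0 //.
rewrite -[leLHS]mul1r; apply: ler_pM; rewrite // ?ler1n ?fact_gt0 //.
apply: le_trans (_ : 2^-1 * 4 ^+ 2 <= _).
  by rewrite (_ : 2^-1 * 4 ^+ 2 = 8%:R) ?ler1n //; field.
apply: ler_pM; rewrite ?invr_ge0 ?exprn_ge0 // ?lerXn2r ?nnegrE //.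
rewrite lerBrDr (le_trans (lerD (lexx _) e_le)) //.
by rewrite (_ : 2^-1 + 2^-1 = 1) //; field.
Qed.

Lemma P_ge1 : 1 <= P.
Proof.
have h : s <= s ^+ (4 * d).
  by rewrite -{1}(expr1 s) ler_weXn2l // muln_gt0 /= ltnW.
rewrite -(ler_pM2l (ltr0n R 2)) mulr1; apply: le_trans power_le_2P.
by apply: le_trans h; apply: le_trans s_ge4; rewrite ler_nat.
Qed.

(** Multiply by [s ^+ (d + 2)]: then [power_le_2P] supplies the missing factor [P], the value of
    [P ^+ d] is known, and [fact_le] absorbs the factorial. *)
Lemma P_pred_bound : d%:R * P ^+ d.-1 * 4 ^+ d * s ^+ (3 * d - 2) <= 2 * n.
Proof.
have sp : 0 < s ^+ (d + 2) by rewrite exprn_gt0 // (lt_le_trans ltr01).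
rewrite -(ler_pM2r sp) -[leLHS]mulrA -exprD.
rewrite (_ : (3 * d - 2 + (d + 2) = 4 * d)%N); last by case: (exponent_facts d_gt1).
apply: le_trans (_ : d%:R * P ^+ d.-1 * 4 ^+ d * (2 * P) <= _).
  by rewrite ler_wpM2l ?mulr_ge0 ?exprn_ge0 // power_le_2P.
rewrite (_ : 4 ^+ d = 2 ^+ d * 2 ^+ d); last by rewrite -exprMn -natrM.
rewrite (_ : _ * (2 * P) = 2 * d%:R * 2 ^+ d * (P ^+ d * 2 ^+ d)); last first.
  by rewrite -[X in _ = _ * (P ^+ X * _)](prednK (ltnW d_gt1)) exprS; ring.
rewrite PdE exprD.
rewrite [leLHS](_ : _ = 2 * n * (d%:R * (d`!)%:R * 2 ^+ d * ((1 - e) * s ^+ 2))); last by ring.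
rewrite ler_wpM2l ?mulr_ge0 //; apply: ler_pM; rewrite ?mulr_ge0 ?exprn_ge0 //.
by rewrite -[leRHS]mul1r ler_wpM2r ?exprn_ge0 // lerBlDr lerDl.
Qed.

Lemma meet_bound : d%:R * P ^+ d.-1 * 4 ^+ d * s ^+ 4 <= 2 * n.
Proof.
apply: le_trans P_pred_bound; rewrite ler_wpM2l ?mulr_ge0 ?exprn_ge0 //.
by rewrite ler_weXn2l //; case: (exponent_facts d_gt1).
Qed.

Lemma small_bound : (2 * d)%:R ^+ d * (d%:R * P ^+ d.-1) * s ^+ 2 <= 2 * n.
Proof.
apply: le_trans P_pred_bound; rewrite -mulrA mulrCA -mulrA.
rewrite ler_wpM2l ?mulr_ge0 ?exprn_ge0 //.
apply: le_trans (_ : s ^+ d * s ^+ 2 <= _); first by rewrite ler_wpM2r ?exprn_ge0.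
rewrite -exprD -[leLHS]mul1r; apply: ler_pM; rewrite ?exprn_ge0 //.
  by rewrite exprn_ege1 // ler1n.
by rewrite ler_weXn2l //; case: (exponent_facts d_gt1).
Qed.
End Estimates.

(** * Exponential estimates and the bound on [d] *)

Lemma pow_1B_ge_expR (R : realType) (q e L : R) m :
  0 <= q -> q <= e / 2 -> 0 < e -> e <= 2^-1 -> 0 <= L ->
  q * m%:R <= (1 - e) * L -> expR (- ((1 - e / 2) * L)) <= (1 - q) ^+ m.
Proof.
move=> q0 qe e0 e_le L0 qm.
have q1 : 0 < 1 - q by lra.
(* Apply [1 + x <= expR x] at [x = q / (1 - q)], where [1 + x] is the inverse of [1 - q]. The
   division by [1 - q] is paid for by weakening [1 - e] to [1 - e / 2]. *)
have base : expR (- (q / (1 - q))) <= 1 - q.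
  rewrite expRN -[leRHS]invrK lef_pV2 ?posrE ?expR_gt0 ?invr_gt0 //.
  apply: le_trans (expR_ge1Dx _); rewrite le_eqVlt; apply/orP; left; apply/eqP.
  by field; rewrite gt_eqF.
apply: le_trans (_ : expR (- (q / (1 - q))) ^+ m <= _); last first.
  by rewrite lerXn2r // nnegrE ?expR_ge0 // ltW.
rewrite -expRM_natl ler_expR mulrN lerN2 mulrA ler_pdivrMr //.
rewrite mulrC; apply: le_trans qm _.
rewrite [leRHS]mulrAC ler_wpM2r //.
by apply: le_trans (_ : (1 - e / 2) * (1 - e / 2) <= _); [nra | rewrite ler_wpM2l; lra].
Qed.

(** The exponent is split: [e / 4 * L >= d] takes care of [2 ^+ d], and two factors
    [expR (e / 8 * L)], each at least [e / 8 * L], take care of [C * L]. *)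
Lemma expR_beats_linear (R : realType) (e C L : R) d :
  0 < e -> 0 < C -> 16 / e ^+ 2 <= L -> 64 * C / e ^+ 2 <= L ->
  4 * d%:R ^+ 2 <= L -> C * (2 ^+ d * L) <= expR (e / 2 * L).
Proof.
move=> e0 C0 L1 L2 dL.
have e2 : 0 < e ^+ 2 by rewrite exprn_gt0.
have L0 : 0 < L by apply: lt_le_trans L1; rewrite divr_gt0.
move: L1 L2; rewrite !ler_pdivrMr // => L1 L2.
have eL k : 0 <= e / k.+1%:R * L by apply: ltW; rewrite !mulr_gt0 // invr_gt0 ltr0n.
have dle : d%:R <= e / 4 * L.
  rewrite -(@ler_pXn2r _ 2) ?nnegrE ?(eL 3) //.
  have : L * 16 <= L * (L * e ^+ 2) by rewrite ler_pM2l.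
  have := dL; rewrite !expr2; nra.
have -> : e / 2 * L = e / 4 * L + e / 4 * L by lra.
rewrite expRD mulrCA; apply: ler_pM; first by rewrite exprn_ge0.
- by apply: ltW; rewrite mulr_gt0.
- apply: le_trans (_ : expR d%:R <= _); last by rewrite ler_expR.
  rewrite -[d%:R]mulr1 expRM_natl lerXn2r ?nnegrE ?expR_ge0 //.
  by apply: le_trans (expR_ge1Dx 1).
have -> : e / 4 * L = e / 8 * L + e / 8 * L by lra.
rewrite expRD; have h : e / 8 * L <= expR (e / 8 * L).
  by apply: le_trans (expR_ge1Dx _); rewrite lerDr.
apply: le_trans (ler_pM _ _ h h); rewrite ?(eL 7) //.
have : L * (64 * C) <= L * (L * e ^+ 2) by rewrite ler_pM2l.
rewrite expr2; nra.
Qed.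

(** Squaring [d <= d_N] gives [2 * d ^ 2 * ln L <= L]. Exponentiating gives the second bound, and
    [ln L >= 2] the first. For [s = sqrt L] they become [2 * d <= s] and [s ^+ (4 * d ^ 2) <= N]. *)
Lemma dN_bounds (R : realType) (gam : R) (N d : nat) (L := ln N%:R : R) :
  0 < gam < 1 -> expR 2 <= L -> d%:R <= dN gam N ->
  4 * d%:R ^+ 2 <= L /\ L ^+ (2 * d ^ 2) <= expR L.
Proof.
case/andP=> g0 g1 L2 dle.
have L0 : 0 < L by apply: lt_le_trans L2; rewrite expR_gt0.
have lnL : 2 <= ln L by rewrite -[leLHS](@expRK R) ler_ln ?posrE ?expR_gt0.
have ln2 : 0 < 2 * ln L by lra.
have h : d%:R ^+ 2 * (2 * ln L) <= L.
  rewrite -ler_pdivlMr // -[leRHS]sqr_sqrtr; last by rewrite divr_ge0 // ltW.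
  rewrite lerXn2r ?nnegrE ?sqrtr_ge0 //; apply: le_trans dle _.
  by rewrite /dN -/L -[leRHS]mul1r ler_wpM2r ?sqrtr_ge0 //; lra.
split.
  have := ler_wpM2l (sqr_ge0 (d%:R : R)) lnL; lra.
rewrite -{1}(lnK L0) -expRM_natl ler_expR natrM natrX.
by apply: le_trans h; rewrite le_eqVlt; apply/orP; left; apply/eqP; ring.
Qed.

(** Allows [eps] to be replaced by its minimum with 1/2. *)
Lemma pbound_pow_le (R : realType) (eps e : R) d N : (0 < N)%N -> e <= eps ->
  pbound_pow eps d N <= pbound_pow e d N.
Proof.
move=> N0 ee; rewrite /pbound_pow ler_wpM2r //.
  by rewrite divr_ge0 ?exprn_ge0 // ln_ge0 // ler1n.
by rewrite ler_wpM2r ?invr_ge0 ?exprn_ge0 // ler_wpM2l // lerB.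
Qed.

(** * The error terms for a group of large order *)

Section Regime.
Variables (R : realType) (gT : finGroupType) (p e eta : R) (d : nat).
Local Notation n := (#|gT|%:R : R).
Variable s : R.
Hypotheses (abG : abelian [set: gT]) (p01 : 0 <= p <= 1) (d_gt1 : (1 < d)%N).
Hypotheses (s_ge : (2 * d)%:R <= s) (n_ge : s ^+ (4 * d ^ 2) <= n).
Hypotheses (e_gt0 : 0 < e) (e_le : e <= 2^-1).
Hypotheses (eta_gt0 : 0 < eta) (eta_le : eta <= 8^-1).
Hypotheses (nE : expR (s ^+ 2) = n) (p_le : p ^+ d <= threshold d s n e).
Hypotheses (s_eta : 16 <= eta * s ^+ 2) (s_e : 2 <= e * s ^+ 2).

Let e_ge0 : 0 <= e. Proof. exact: ltW. Qed.
Let p0 : 0 <= p. Proof. by case/andP: p01. Qed.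
Let n_gt0 : 0 < n. Proof. by rewrite -nE expR_gt0. Qed.
Let d_gt0 : (0 < d)%N. Proof. exact: ltnW. Qed.
Let s2_gt0 : 0 < s ^+ 2.
Proof.
rewrite exprn_gt0 //; apply: lt_le_trans s_ge.
by rewrite ltr0n muln_gt0.
Qed.

Lemma regime_power_le : p ^+ d * s ^+ 2 <= 1.
Proof.
apply: le_trans (threshold_le d_gt1 s_ge n_ge e_ge0 e_le).
by rewrite ler_wpM2r // ltW.
Qed.

Lemma regime_main_sets (x : gT) : p ^+ d * #|main_sets d x|%:R <= (1 - e) * s ^+ 2.
Proof.
have f0 : 0 < (d`!)%:R :> R by rewrite ltr0n fact_gt0.
rewrite -(ler_pM2l f0) -(threshold_count e d_gt1 s_ge n_ge) mulrCA.
apply: ler_pM; rewrite ?exprn_ge0 ?mulr_ge0 //.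
exact: card_main_sets.
Qed.

(** [P] is [n] times the [d]-th root of the threshold, hence an upper bound for [n * p] for every
    admissible [p]. *)
Lemma regime_scale :
  (exists2 P, n * p <= P & [/\ 1 <= P,
   d%:R * P ^+ d.-1 * 4 ^+ d * s ^+ 4 <= 2 * n &
   (2 * d)%:R ^+ d * (d%:R * P ^+ d.-1) * s ^+ 2 <= 2 * n]).
Proof.
have [r r0 rE] := exists_root d_gt0 (threshold_ge0 d_gt1 s_ge n_ge e_le).
have P0 : 0 <= n * r by rewrite mulr_ge0.
have PE : (n * r) ^+ d = n ^+ d * threshold d s n e by rewrite exprMn rE.
exists (n * r); last split.
- rewrite ler_pM2l // -(@ler_pXn2r _ d) ?nnegrE // rE //.
- exact: P_ge1 PE.
- exact: meet_bound PE.
- exact: small_bound PE.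
Qed.

Lemma regime_meet :
  4 * (2 * 4 ^+ d * p * small_weight gT p d.-2) * s ^+ 2 <= eta.
Proof.
have [P nP [P1 h _]] := regime_scale.
have P0 : 0 <= P by exact: le_trans P1.
have W0 := small_weight_ge0 gT p01 d.-2.
have pW : n * (p * small_weight gT p d.-2) <= d%:R * P ^+ d.-1.
  rewrite mulrA; apply: le_trans (_ : P * (d.-2.+1%:R * P ^+ d.-2) <= _).
    by apply: ler_pM; rewrite ?mulr_ge0 // small_weight_le.
  rewrite mulrCA -exprS; have -> : d.-2.+1 = d.-1 by case: d d_gt1 => [|[|k]].
  by rewrite ler_wpM2r ?exprn_ge0 // ler_nat leq_pred.
rewrite -(ler_pM2r (mulr_gt0 n_gt0 s2_gt0)).
apply: le_trans (_ : 8 * (d%:R * P ^+ d.-1 * 4 ^+ d * s ^+ 4) <= _).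
  rewrite [leLHS](_ : _ = 8 * (n * (p * small_weight gT p d.-2) * 4 ^+ d * s ^+ 4)).
    by rewrite ler_wpM2l // !ler_wpM2r ?exprn_ge0 //; apply: ltW; rewrite (lt_le_trans _ s_ge) // ltr0n muln_gt0.
  by rewrite (exprD s 2 2); ring.
apply: le_trans (ler_wpM2l (ler0n R 8) h) _.
rewrite [leLHS](_ : _ = 16 * n); last by ring.
rewrite [leRHS](_ : _ = eta * s ^+ 2 * n); last by ring.
by apply: ler_wpM2r.
Qed.

Lemma regime_small :
  (2 * d)%:R ^+ d * small_weight gT p d.-1 <= eta * (n / 2).
Proof.
have [P nP [P1 _ h]] := regime_scale.
rewrite -(ler_pM2r s2_gt0); apply: le_trans (_ : 2 * n <= _).
  apply: le_trans h; apply: ler_wpM2r; first exact: ltW.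
  apply: ler_wpM2l; first exact: exprn_ge0.
  by rewrite -{2}(prednK d_gt0) small_weight_le.
rewrite (_ : eta * (n / 2) * s ^+ 2 = eta * s ^+ 2 / 2 * n); last by ring.
rewrite ler_wpM2r // ler_pdivlMr //.
by apply: le_trans s_eta; rewrite -natrM ler_nat.
Qed.

Lemma regime_diam_prob :
  cayley_prob p (fun S : {set gT} => diam_le S d) <=
  8 * eta + (2 ^+ d * s ^+ 2 / eta) / (expR (e / 2 * s ^+ 2) / 4).
Proof.
have q0 : 0 <= p ^+ d by rewrite exprn_ge0.
have qe : p ^+ d <= e / 2.
  rewrite -(ler_pM2r s2_gt0); apply: le_trans regime_power_le _.
  by rewrite mulrAC ler_pdivlMr // mul1r.
have main_le (x : gT) : p ^+ d * #|main_sets d x|%:R <= s ^+ 2.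
  apply: le_trans (regime_main_sets x) _.
  rewrite -[leRHS]mul1r; apply: ler_wpM2r; first exact: ltW.
  by rewrite lerBlDr lerDl.
have q_half : p ^+ d <= 2^-1.
  apply: le_trans qe _; rewrite ler_pdivrMr // mulVf ?pnatr_eq0 //.
  by apply: le_trans e_le _; rewrite invf_le1 // ler1n.
(* As [n = expR (s ^+ 2)], this exhibits the lower bound [a = expR (- ((1 - e / 2) * s ^+ 2))] for
   the probability of avoiding all main sets. *)
rewrite [X in _ / (X / 4)](_ : _ = n * expR (- ((1 - e / 2) * s ^+ 2))).
  apply: (diam_prob_le abG p01 d_gt1 q_half eta_gt0 eta_le main_le regime_meet).
  - exact: expR_gt0.
  - exact: regime_small.
  by move=> x; apply: pow_1B_ge_expR; rewrite ?regime_main_sets // ltW.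
by rewrite -nE -expRD; congr expR; ring.
Qed.
End Regime.

Theorem theorem3 (R : realType) (eps gam : R) :
  0 < eps -> 0 < gam < 1 ->
  forall delta : R, 0 < delta ->
  exists N0 : nat,
    forall (gT : finGroupType), abelian [set: gT] -> (N0 <= #|gT|)%N ->
    forall d : nat, (2 <= d)%N -> d%:R <= dN gam #|gT| ->
    forall p : R, 0 <= p <= 1 -> p ^+ d <= pbound_pow eps d #|gT| ->
      cayley_prob p (fun S : {set gT} => diam_le S d) < delta.
Proof.
move=> eps0 gam01 delta delta0.
pose e := Num.min eps 2^-1.
(* Makes the first error term [8 * eta] at most [delta / 4]. *)
pose eta := Num.min 8^-1 (delta / 32).
have e_gt0 : 0 < e by rewrite lt_min eps0 invr_gt0 ltr0n.
have e_le : e <= 2^-1 by rewrite ge_min lexx orbT.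
have e_eps : e <= eps by rewrite ge_min lexx.
have eta_gt0 : 0 < eta by rewrite lt_min invr_gt0 ltr0n divr_gt0.
have eta_le : eta <= 8^-1 by rewrite ge_min lexx.
have eta_delta : eta <= delta / 32 by rewrite ge_min lexx orbT.
(* With this constant, [C * y <= E] says exactly that [y / eta / (E / 4) <= delta / 2]. *)
pose C := 8 / (eta * delta).
have C0 : 0 < C by rewrite divr_gt0 ?mulr_gt0.
have e2 : 0 < e ^+ 2 by rewrite exprn_gt0.
(* A sum of nonnegative terms, so at least each of the five lower bounds required of [log N]. *)
pose L0 := expR 2 + 16 / eta + 2 / e + 16 / e ^+ 2 + 64 * C / e ^+ 2.
have [t1 t2 t3 t4 t5] : [/\ expR 2 <= L0, 16 / eta <= L0, 2 / e <= L0,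
    16 / e ^+ 2 <= L0 & 64 * C / e ^+ 2 <= L0].
  have u1 : 0 <= expR 2 :> R by exact: expR_ge0.
  have u2 : 0 <= 16 / eta by rewrite divr_ge0 // ltW.
  have u3 : 0 <= 2 / e by rewrite divr_ge0 // ltW.
  have u4 : 0 <= 16 / e ^+ 2 by rewrite divr_ge0 // ltW.
  have u5 : 0 <= 64 * C / e ^+ 2 by apply: divr_ge0; [rewrite mulr_ge0 //; exact: ltW | exact: ltW].
  move: u1 u2 u3 u4 u5; rewrite /L0; move: (16 / eta) (16 / e ^+ 2) (64 * C / _).
  move: (2 / e) (@expR R 2) => a1 a2 a3 a4 a5 u1 u2 u3 u4 u5.
  by clear -u1 u2 u3 u4 u5; split; lra.
exists (Num.bound (expR L0)) => gT abG N0_le d d_gt1 d_le p p01 p_le.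
have n_ge : expR L0 <= #|gT|%:R.
  apply: le_trans (_ : (Num.bound (expR L0))%:R <= _); last by rewrite ler_nat.
  exact/ltW/archi_boundP/expR_ge0.
have n_gt0 : 0 < #|gT|%:R :> R by apply: lt_le_trans n_ge; rewrite expR_gt0.
pose L : R := ln #|gT|%:R.
have L0_le : L0 <= L by rewrite -[leLHS]expRK ler_ln ?posrE ?expR_gt0.
have nE : expR L = #|gT|%:R by rewrite lnK.
have [d2 Ld] := dN_bounds gam01 (le_trans t1 L0_le) d_le.
have Lge0 : 0 <= L by apply: le_trans d2; rewrite mulr_ge0 ?exprn_ge0.
pose s := Num.sqrt L.
have s2 : s ^+ 2 = L by rewrite sqr_sqrtr.
have s_ge : (2 * d)%:R <= s.
  rewrite -(@ler_pXn2r _ 2) ?nnegrE ?sqrtr_ge0 // s2; apply: le_trans d2.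
  by rewrite (_ : (2 * d)%:R ^+ 2 = 4 * d%:R ^+ 2) // natrM; ring.
have s_pow : s ^+ (4 * d ^ 2) <= #|gT|%:R.
  by rewrite -nE; apply: le_trans Ld; rewrite -(mulnA 2 2) exprM s2.
have p_le' : p ^+ d <= threshold d s #|gT|%:R e.
  apply: le_trans p_le _; rewrite /threshold s2.
  by apply: pbound_pow_le e_eps; rewrite -(ltr0n R).
apply: le_lt_trans (_ : _ <= 8 * eta + (2 ^+ d * s ^+ 2 / eta) /
   (expR (e / 2 * s ^+ 2) / 4)) _.
  apply: regime_diam_prob => //; rewrite ?s2 //.
    by rewrite mulrC -ler_pdivrMr // (le_trans t2).
  by rewrite mulrC -ler_pdivrMr // (le_trans t3).
rewrite s2.
have := expR_beats_linear e_gt0 C0 (le_trans t4 L0_le) (le_trans t5 L0_le) d2.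
have := expR_gt0 (e / 2 * L).
move: (expR _) (2 ^+ d * L) => E y E0 yE.
have h : y / eta / (E / 4) <= delta / 2.
  rewrite ler_pdivrMr ?divr_gt0 // ler_pdivrMr //.
  move: yE; rewrite /C mulrAC ler_pdivrMr ?mulr_gt0 // => yE.
  by move: yE; lra.
by move: h eta_delta delta0; lra.
Qed.
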